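(* Let $\eta\in(0,1/2)$. For all integers $d\ge2$, $N\ge1$ and every $\mathbf a\in\mathcal W$, $$\frac{1}{\#\mathcal T_{\mathbf a,\mathcal W^2}}\#\Bigl\{(\mathbf v_1,\mathbf v_2)\in\mathcal T_{\mathbf a,\mathcal W^2}:\bigl|\operatorname{dist}_d(\mathbf a,\mathbf v_1)-\operatorname{dist}_d(\mathbf a,\mathbf v_2)\bigr|\le\tfrac2{d^\eta}\Bigr\}\ge1-\frac{102}{15}\cdot\frac1{d^{1-2\eta}}.$$
   Context: $\mathcal W=\{0,1,\dots,N\}^d$. $\operatorname{dist}_d(\mathbf u,\mathbf v)=\frac{1}{\sqrt d\,N}\bigl(\sum_j(u_j-v_j)^2\bigr)^{1/2}$. $\mathcal T_{\mathbf a,\mathcal W^2}\subset\mathcal W^2$ is the set of pairs $(\mathbf v_1,\mathbf v_2)$ of integer points which together with $\mathbf a$ form a non-degenerate triangle. *)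

(* Defs.v *)
From mathcomp Require Import all_boot all_order all_algebra.
From mathcomp Require Import all_classical all_reals all_analysis.
Set Implicit Arguments.
Unset Strict Implicit.
Unset Printing Implicit Defensive.
Import Order.TTheory GRing.Theory Num.Theory.
Local Open Scope ring_scope.

Definition grid (d N : nat) : finType := {ffun 'I_d -> 'I_N.+1}.

Definition pt (R : realType) (d N : nat) (v : grid d N) : 'rV[R]_d :=
  \row_j (v j : nat)%:R.

Definition dist (R : realType) (d N : nat) (u v : grid d N) : R :=
  1 / (Num.sqrt d%:R * N%:R) *
  Num.sqrt (\sum_(j < d) ((u j : nat)%:R - (v j : nat)%:R) ^+ 2).

(* The points a, v1, v2 of R^d are affinely independent: the two edge vectors
   issued from a are linearly independent. *)
Definition nondegenerate_triangle (R : realType) (d N : nat)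
    (a v1 v2 : grid d N) : bool :=
  row_free (col_mx (pt R v1 - pt R a) (pt R v2 - pt R a)).

Definition triangles (R : realType) (d N : nat) (a : grid d N) :
    {set grid d N * grid d N} :=
  [set p | nondegenerate_triangle R a p.1 p.2].

(* Main.v *)
(* The squared normalized distance [X] from [a] to a uniform point of the grid
   is an average of [d] independent variables with values in [0, 1], so that
   [Var X <= E X / d]. Since [(sqrt x - sqrt m)^2 <= (x - m)^2 / m], this yields
   [E (D1 - D2)^2 <= 2 Var X / E X <= 2 / d] for the distances [D1], [D2] to two
   independent points, and Chebyshev's inequality bounds the proportion of bad
   pairs in the whole product by [d^(2 eta - 1) / 2]. For [v1 != a] a degenerate
   [v2] lies on the line through [a] and [v1], hence is determined by a single
   coordinate; so the triangles make up at least 3/8 of all pairs. *)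

Require Import Defs.
From mathcomp Require Import all_boot all_order all_algebra.
From mathcomp Require Import all_classical all_reals all_analysis.
From mathcomp Require Import ring lra zify.
Import Order.TTheory GRing.Theory Num.Theory.
Local Open Scope ring_scope.

(** * Linear independence and the count of degenerate triangles *)

Lemma row_free_col_mx_minor (F : fieldType) (d : nat) (u v : 'rV[F]_d)
    (i j : 'I_d) :
  u 0 i * v 0 j != u 0 j * v 0 i -> row_free (col_mx u v).
Proof.
move=> minor_neq0; apply: inj_row_free => w.
rewrite -[w]hsubmxK mul_row_col => /rowP w0.
have combination k :
    lsubmx w 0 0 * u 0 k + rsubmx w 0 0 * v 0 k = 0.
  by have := w0 k; rewrite !mxE !big_ord1 !mxE.
(* As in Cramer's rule, combining the equations at [i] and [j] eliminates one coefficient and leaves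
   the other multiplied by the minor. *)
have minor_unit : u 0 i * v 0 j - u 0 j * v 0 i != 0 by rewrite subr_eq0.
have l0 : lsubmx w 0 0 = 0.
  apply: (mulIf minor_unit); rewrite mul0r.
  have -> : lsubmx w 0 0 * (u 0 i * v 0 j - u 0 j * v 0 i) =
    (lsubmx w 0 0 * u 0 i + rsubmx w 0 0 * v 0 i) * v 0 j -
    (lsubmx w 0 0 * u 0 j + rsubmx w 0 0 * v 0 j) * v 0 i by ring.
  by rewrite !combination !mul0r subrr.
have r0 : rsubmx w 0 0 = 0.
  apply: (mulIf minor_unit); rewrite mul0r.
  have -> : rsubmx w 0 0 * (u 0 i * v 0 j - u 0 j * v 0 i) =
    (lsubmx w 0 0 * u 0 j + rsubmx w 0 0 * v 0 j) * u 0 i -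
    (lsubmx w 0 0 * u 0 i + rsubmx w 0 0 * v 0 i) * u 0 j by ring.
  by rewrite !combination !mul0r subrr.
have -> : lsubmx w = 0 by apply/rowP => k; rewrite ord1 l0 mxE.
have -> : rsubmx w = 0 by apply/rowP => k; rewrite ord1 r0 mxE.
exact: row_mx0.
Qed.

Lemma card_degenerate_le (R : realType) (d N : nat) (a v : grid d N) :
  v != a ->
  (#|[set w | ~~ nondegenerate_triangle R a v w]| <= N.+1)%N.
Proof.
move=> va.
have [j vaj] : exists j, v j != a j.
  apply/existsP; apply: contraNT va => /existsPn eq_va.
  by apply/eqP/ffunP => j; apply/eqP; have := eq_va j; rewrite negbK.
have vaj0 : (v j : nat)%:R - (a j : nat)%:R != 0 :> R.
  by rewrite subr_eq0 eqr_nat.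
(* Evaluation at [j], a coordinate where [v] and [a] differ, is injective on the degenerate [w]: the
   vanishing minors recover every [w i] from [w j]. *)
rewrite -[X in (_ <= X)%N]card_ord -(@card_in_imset _ _ (fun w : grid d N => w j)).
  exact: max_card.
have colinear (w : grid d N) i : ~~ nondegenerate_triangle R a v w ->
    ((v j : nat)%:R - (a j : nat)%:R) * ((w i : nat)%:R - (a i : nat)%:R) =
    ((v i : nat)%:R - (a i : nat)%:R) * ((w j : nat)%:R - (a j : nat)%:R) :> R.
  move=> deg; apply/eqP; apply: contraNT deg => minor.
  by apply: (@row_free_col_mx_minor _ _ _ _ j i); rewrite !mxE.
move=> w w'; rewrite !inE => deg deg' ww'; apply/ffunP => i; apply/eqP.
have := colinear w i deg; rewrite ww' -(colinear w' i deg').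
by move/(mulfI vaj0)/addIr/eqP; rewrite eqr_nat.
Qed.

Lemma card_grid (d N : nat) : #|grid d N| = (N.+1 ^ d)%N.
Proof. by rewrite card_ffun !card_ord. Qed.

Lemma card_triangles_ge (R : realType) (d N : nat) (a : grid d N) :
  (2 <= d)%N -> (1 <= N)%N ->
  (3 * #|grid d N| ^ 2 <= 8 * #|triangles R a|)%N.
Proof.
move=> hd hN.
have card_sum :
    #|triangles R a| = (\sum_v #|[set w | nondegenerate_triangle R a v w]|)%N.
  rewrite -sum1_card big_mkcond /=.
  transitivity (\sum_(p : grid d N * grid d N)
    (if nondegenerate_triangle R a p.1 p.2 then 1 else 0))%N.
    by apply: eq_bigr => p _; rewrite inE.
  rewrite -(pair_bigA _ (fun v w : grid d N =>
    if nondegenerate_triangle R a v w then 1%N else 0%N)) /=.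
  apply: eq_bigr => v _; rewrite -big_mkcond -sum1_card.
  by apply: eq_bigl => w; rewrite !inE.
have card_ge (v : grid d N) : v != a ->
    (#|grid d N| - N.+1 <= #|[set w | nondegenerate_triangle R a v w]|)%N.
  move=> /card_degenerate_le - /(_ R).
  have := cardsC [set w | nondegenerate_triangle R a v w].
  have -> : ~: [set w | nondegenerate_triangle R a v w] =
    [set w | ~~ nondegenerate_triangle R a v w].
    by apply/setP => w; rewrite !inE.
  lia.
have T_ge : ((#|grid d N| - 1) * (#|grid d N| - N.+1) <= #|triangles R a|)%N.
  rewrite card_sum (bigD1 a) //=; apply: leq_trans (leq_addl _ _).
  apply: leq_trans (leq_sum _ card_ge); rewrite sum_nat_const leq_mul2r.
  by rewrite (cardC1 a) subn1 leqnn orbT.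
move: T_ge; rewrite card_grid.
case: d hd a {card_sum card_ge} => [//|[//|d]] _ a.
rewrite expnS; set P := (N.+1 ^ d.+1)%N.
have P2 : (2 <= P)%N.
  by apply: leq_trans (leq_pexp2l _ (ltn0Sn d)); rewrite ?expn1.
set T := #|_|; set M := N.+1 => T_ge.
have M2 : (2 <= M)%N by [].
(* The constant is 3/8 = 3/4 * 1/2: discarding [a] keeps 3/4 of the grid since [M * P >= 4], and
   discarding at most [M] degenerate points keeps half of it since [P >= 2]. *)
have h1 : (3 * (M * P) <= 4 * (M * P - 1))%N by nia.
have h2 : (M * P <= 2 * (M * P - M))%N by nia.
have := leq_mul h1 h2; nia.
Qed.

(** * Moments of independent uniform coordinates *)

Lemma sum_ffun_coord (R : realType) (I J : finType) (i : I) (f : J -> R) :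
  #|J|%:R * (\sum_(v : {ffun I -> J}) f (v i)) =
  #|{ffun I -> J}|%:R * \sum_k f k.
Proof.
(* Padding with factors 1 gives a product over all coordinates, so the sum over functions factors
   into a product of sums over [J]. *)
have prod_if (v : {ffun I -> J}) :
    \prod_l (if l == i then f (v l) else 1) = f (v i).
  by rewrite (bigD1 i) //= eqxx big1 ?mulr1 // => l /negPf ->.
under eq_bigr do rewrite -prod_if.
rewrite -(bigA_distr_bigA (fun l k => if l == i then f k else 1)) /=.
rewrite (bigD1 i) //= eqxx.
under [X in _ * (_ * X)]eq_bigr => l /negPf -> do rewrite sumr_const.
rewrite prodr_const card_ffun natrX (cardC1 i).
have /prednK {2}<- : (0 < #|I|)%N by apply/card_gt0P; exists i.
rewrite exprS; ring.
Qed.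

(** Independence of two coordinates: the sum factors, and the factor at [i] is the vanishing sum of
    [f]. This removes the covariances from the variance below. *)
Lemma sum_ffun_coord2_eq0 (R : realType) (I J : finType) (i j : I)
    (f g : J -> R) :
  i != j -> \sum_k f k = 0 ->
  \sum_(v : {ffun I -> J}) f (v i) * g (v j) = 0.
Proof.
move=> ij f0.
have prod_if (v : {ffun I -> J}) :
    \prod_l (if l == i then f (v l) else if l == j then g (v l) else 1) =
    f (v i) * g (v j).
  have ji : j != i by rewrite eq_sym.
  rewrite (bigD1 i) //= eqxx (bigD1 j) //= eqxx (negPf ji).
  by rewrite big1 ?mulr1 // => l /andP[/negPf -> /negPf ->].
under eq_bigr do rewrite -prod_if.
rewrite -(bigA_distr_bigA (fun l k =>
  if l == i then f k else if l == j then g k else 1)) /=.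
by rewrite (bigD1 i) //= eqxx f0 mul0r.
Qed.

(* The coordinates are independent, and [Var Y <= E Y] for [0 <= Y <= 1]. *)
Lemma variance_sum_le (R : realType) (I J : finType) (Y : I -> J -> R)
    (A := #|J|%:R^-1 * \sum_i \sum_k Y i k) :
  (0 < #|J|)%N -> (forall i k, 0 <= Y i k <= 1) ->
  \sum_(v : {ffun I -> J}) (\sum_i Y i (v i) - A) ^+ 2 <=
  #|{ffun I -> J}|%:R * A.
Proof.
move=> J0 Y01.
have J0R : #|J|%:R != 0 :> R by rewrite pnatr_eq0 -lt0n.
pose m i := #|J|%:R^-1 * \sum_k Y i k.
have Am : A = \sum_i m i by rewrite /A mulr_sumr.
pose Z i k := Y i k - m i.
have sumZ i : \sum_k Z i k = 0.
  by rewrite sumrB sumr_const -mulr_natl /m mulrA mulfV // mul1r subrr.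
have -> : \sum_(v : {ffun I -> J}) (\sum_i Y i (v i) - A) ^+ 2 =
    \sum_i \sum_(v : {ffun I -> J}) Z i (v i) ^+ 2.
  under eq_bigr do rewrite Am -sumrB expr2 mulr_suml.
  rewrite exchange_big /=; apply: eq_bigr => i _.
  under eq_bigr do rewrite mulr_sumr.
  rewrite exchange_big /= (bigD1 i) //= [X in _ + X]big1 ?addr0 // => j ji.
  by apply: (@sum_ffun_coord2_eq0 _ _ _ i j (Z i) (Z j)) => //; rewrite eq_sym.
rewrite Am mulr_sumr; apply: ler_sum => i _.
have J0p : 0 < #|J|%:R :> R by rewrite ltr0n.
rewrite -(ler_pM2l J0p) (@sum_ffun_coord _ _ _ i (fun k => Z i k ^+ 2)).
rewrite mulrCA ler_wpM2l // /m mulrA mulfV // mul1r.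
(* Variance as second moment minus squared mean; the latter is then dropped, and [Y ^+ 2 <= Y] on
   [0, 1]. *)
have -> : \sum_k Z i k ^+ 2 = \sum_k Y i k ^+ 2 - #|J|%:R * m i ^+ 2.
  rewrite (eq_bigr (fun k => Y i k ^+ 2 - m i *+ 2 * Z i k - m i ^+ 2)).
    by rewrite !sumrB -mulr_sumr sumZ mulr0 subr0 sumr_const mulr_natl.
  by move=> k _; rewrite /Z; ring.
apply: (@le_trans _ _ (\sum_k Y i k ^+ 2)).
  by rewrite gerBl mulr_ge0 // sqr_ge0.
by apply: ler_sum => k _; rewrite expr2 ler_piMl //; case/andP: (Y01 i k).
Qed.

(** * Concentration of the distances to [a] *)

Lemma sum_pair_sqr_dist_le (R : realType) (T : finType) (D : T -> R) (s : R) :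
  \sum_(p : T * T) (D p.1 - D p.2) ^+ 2 <=
  2 * #|T|%:R * \sum_v (D v - s) ^+ 2.
Proof.
rewrite -(pair_bigA _ (fun v w => (D v - D w) ^+ 2)) /=.
pose E v := D v - s.
(* The identity holds around any centre [s], which allows the square root of a mean to be used later
   in place of the mean of [D]. *)
have -> : \sum_v \sum_w (D v - D w) ^+ 2 =
    2 * #|T|%:R * (\sum_v E v ^+ 2) - 2 * (\sum_v E v) ^+ 2.
  have inner v : \sum_w (D v - D w) ^+ 2 =
      #|T|%:R * E v ^+ 2 - (2 * \sum_w E w) * E v + \sum_w E w ^+ 2.
    transitivity (\sum_w (E v ^+ 2 - (2 * E v) * E w + E w ^+ 2)).
      by apply: eq_bigr => w _; rewrite /E; ring.
    rewrite big_split /= sumrB sumr_const -mulr_sumr -mulr_natl.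
    by congr (_ + _); ring.
  under eq_bigr do rewrite inner.
  rewrite big_split /= sumrB sumr_const -!mulr_sumr -mulr_natl.
  by ring.
by rewrite gerBl mulr_ge0 // sqr_ge0.
Qed.

Lemma chebyshev_card (R : realType) (T : finType) (A : {set T}) (f : T -> R)
    (t : R) :
  0 <= t -> (forall x, x \in A -> t <= `|f x|) ->
  #|A|%:R * t ^+ 2 <= \sum_x f x ^+ 2.
Proof.
move=> t0 At; rewrite [leRHS](bigID (mem A)) /=.
rewrite -[leLHS]addr0; apply: lerD; last by apply: sumr_ge0 => x _; exact: sqr_ge0.
rewrite mulr_natl -sumr_const; apply: ler_sum => x /At tx.
by rewrite -[leRHS]real_normK ?num_real // ler_sqr // nnegrE.
Qed.

(** Factor [x - y] as the difference times the sum of the square roots; that sum is at least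
    [Num.sqrt y]. *)
Lemma sqr_sub_sqrt_le (R : realType) (x y : R) : 0 <= x -> 0 < y ->
  (Num.sqrt x - Num.sqrt y) ^+ 2 <= (x - y) ^+ 2 / y.
Proof.
move=> x0 y0; rewrite ler_pdivlMr //.
rewrite -[in leRHS](sqr_sqrtr x0) -[in leRHS](sqr_sqrtr (ltW y0)).
rewrite -[X in _ * X](sqr_sqrtr (ltW y0)) subr_sqr exprMn.
by rewrite ler_wpM2l ?sqr_ge0 // ler_sqr ?nnegrE ?addr_ge0 ?sqrtr_ge0 //
  lerDr sqrtr_ge0.
Qed.

Lemma sum_sqr_dist_le (R : realType) (d N : nat) (a : grid d N) :
  (0 < d)%N -> (0 < N)%N ->
  \sum_p (dist R a p.1 - dist R a p.2) ^+ 2 <=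
  2 * #|grid d N|%:R ^+ 2 / d%:R.
Proof.
move=> d0 N0.
have d0R : 0 < d%:R :> R by rewrite ltr0n.
have N0R : 0 < N%:R :> R by rewrite ltr0n.
pose Y (i : 'I_d) (k : 'I_N.+1) : R :=
  (((a i : nat)%:R - (k : nat)%:R) / N%:R) ^+ 2.
have Y01 i k : 0 <= Y i k <= 1.
  rewrite sqr_ge0 /= /Y -real_normK ?num_real // exprn_ile1 //.
  rewrite normrM normfV (gtr0_norm N0R) ler_pdivrMr // mul1r ler_norml.
  have := ltn_ord k; rewrite ltnS -(ler_nat R) => kN.
  have := ltn_ord (a i); rewrite ltnS -(ler_nat R) => aN.
  have := ler0n R k; have := ler0n R (a i).
  by move=> *; apply/andP; split; lra.
(* [A] is the mean of [\sum_i Y i (v i)] over the grid, that is, [d] times the mean squared distance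
   to [a]. *)
pose A : R := #|'I_N.+1|%:R^-1 * \sum_i \sum_k Y i k.
have A0 : 0 < A.
  rewrite mulr_gt0 ?invr_gt0 ?ltr0n ?card_ord //.
  have Yge0 i k : 0 <= Y i k by exact: sqr_ge0.
  rewrite (bigD1 (Ordinal d0)) //= ltr_pwDl //; last first.
    by apply: sumr_ge0 => i _; apply: sumr_ge0.
  set i := Ordinal d0.
  (* Since [N >= 1], some value differs from [a i], so [A] has a positive term. *)
  have [k ka] : exists k : 'I_N.+1, k != a i.
    have [a0|a0] := eqVneq (a i) ord0; last by exists ord0; rewrite eq_sym.
    by exists ord_max; rewrite a0 -val_eqE /= -lt0n.
  rewrite (bigD1 k) //= ltr_pwDl ?sumr_ge0 //.
  rewrite lt_neqAle Yge0 andbT eq_sym /Y expf_neq0 // mulf_neq0 //.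
    by rewrite subr_eq0 eqr_nat eq_sym.
  by rewrite invr_eq0 gt_eqF.
have distE v : dist R a v = Num.sqrt ((\sum_i Y i (v i)) / d%:R).
  have -> : \sum_i Y i (v i) =
      (\sum_j ((a j : nat)%:R - (v j : nat)%:R) ^+ 2) / N%:R ^+ 2.
    by rewrite mulr_suml; apply: eq_bigr => i _; rewrite /Y expr_div_n.
  set S := \sum_j _; have S0 : 0 <= S by apply: sumr_ge0 => j _; exact: sqr_ge0.
  rewrite /dist -/S mul1r mulrC -mulrA -invfM [RHS]sqrtrM // sqrtrV ?mulr_ge0 //.
  by rewrite sqrtrM // sqrtr_sqr (gtr0_norm N0R) [N%:R * _]mulrC.
apply: (le_trans (sum_pair_sqr_dist_le _ _ _ (Num.sqrt (A / d%:R)))).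
have -> : 2 * #|grid d N|%:R ^+ 2 / d%:R =
    2 * #|grid d N|%:R * (#|grid d N|%:R / d%:R) :> R by rewrite expr2 !mulrA.
apply: ler_wpM2l; first by rewrite mulr_ge0.
(* With [S] the sum of the [Y i (v i)], [(S / d - A / d) ^+ 2 / (A / d)] equals
   [(S - A) ^+ 2 / (A * d)]; the variance bound then cancels [A]. *)
apply: (@le_trans _ _ (\sum_(v : grid d N)
    (\sum_i Y i (v i) - A) ^+ 2 / (A * d%:R))).
  apply: ler_sum => v _; rewrite distE.
  apply: le_trans (sqr_sub_sqrt_le _ _ _ _ _) _; rewrite ?divr_gt0 //.
    rewrite divr_ge0 ?sumr_ge0 // => i _.
    by case/andP: (Y01 i (v i)).
  rewrite le_eqVlt; apply/orP; left; apply/eqP; field.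
  by rewrite !gt_eqF.
rewrite -mulr_suml ler_pdivrMr; last exact: mulr_gt0.
have J0 : (0 < #|'I_N.+1|)%N by rewrite card_ord.
have := variance_sum_le _ _ _ Y J0 Y01; rewrite -/A => /le_trans; apply.
rewrite le_eqVlt; apply/orP; left; apply/eqP.
by rewrite -mulrA [A * _]mulrC mulKf ?gt_eqF.
Qed.

Theorem theorem6p2 (R : realType) (eta : R) (heta : 0 < eta < 1 / 2)
    (d N : nat) (hd : (2 <= d)%N) (hN : (1 <= N)%N) (a : grid d N) :
  1 / #|triangles R a|%:R *
    #|[set p in triangles R a |
        `|dist R a p.1 - dist R a p.2| <= 2 / (d%:R `^ eta)]|%:R
  >= 1 - 102 / 15 * (1 / (d%:R `^ (1 - 2 * eta))) :> R.
Proof.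
have d0 : (0 < d)%N by exact: leq_trans hd.
have d0R : 0 < d%:R :> R by rewrite ltr0n.
set q := d%:R `^ eta.
have q0 : 0 < q by exact: powR_gt0.
have -> : d%:R `^ (1 - 2 * eta) = d%:R / q ^+ 2.
  rewrite powRB; last by rewrite (gt_eqF d0R) implybT.
  rewrite powRr1 ?ltW //.
  by rewrite [2 * eta]mulrC powRrM powR_mulrn ?ltW.
set T := triangles R a; set G := [set p in T | _].
set B := T :\: G.
have GB : #|T|%:R = #|G|%:R + #|B|%:R :> R.
  rewrite -natrD -(cardsID G T); congr (_ + _)%:R; apply: eq_card => p.
  by rewrite !inE; case: (nondegenerate_triangle _ _ _ _).
(* The bad triangles are bad pairs, so the second moment over all pairs of grid points bounds their
   number. *)
have B_le : #|B|%:R * (2 / q) ^+ 2 <= 2 * #|grid d N|%:R ^+ 2 / d%:R.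
  apply: le_trans (sum_sqr_dist_le R d N a d0 hN).
  apply: chebyshev_card; first by rewrite divr_ge0 ?ltW.
  move=> p; rewrite !inE; case: (nondegenerate_triangle _ _ _ _) => //=.
  by rewrite andbT -ltNge => /ltW.
have T_ge : 3 * #|grid d N|%:R ^+ 2 <= 8 * #|T|%:R :> R.
  by rewrite -natrX -!natrM ler_nat card_triangles_ge.
have W0 : 0 < #|grid d N|%:R ^+ 2 :> R.
  by rewrite exprn_gt0 // ltr0n card_grid expn_gt0.
(* Triangles exist, so the proportion is a genuine quotient and not the default value of division by
   zero. *)
have T0 : 0 < #|T|%:R :> R by lra.
have -> : #|G|%:R = #|T|%:R - #|B|%:R :> R by rewrite GB addrK.
rewrite !div1r mulrBr mulVf ?gt_eqF // lerD2l lerN2 mulrC ler_pdivrMr //.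
have -> : #|B|%:R = #|B|%:R * (2 / q) ^+ 2 * (q ^+ 2 / 4) :> R.
  by field; rewrite gt_eqF.
apply: le_trans (ler_wpM2r _ B_le) _; first by rewrite divr_ge0 ?sqr_ge0.
have -> : 2 * #|grid d N|%:R ^+ 2 / d%:R * (q ^+ 2 / 4) =
    (#|grid d N|%:R ^+ 2 / 2) * (q ^+ 2 / d%:R) :> R.
  by field; rewrite gt_eqF.
have -> : 102 / 15 * (d%:R / q ^+ 2)^-1 * #|T|%:R =
    (102 / 15 * #|T|%:R) * (q ^+ 2 / d%:R) :> R.
  by field; rewrite !gt_eqF.
(* As [#|T|] is at least 3/8 of all pairs, half the number of pairs is at most 4/3 of [#|T|], well
   below 102/15. *)
by apply: ler_wpM2r; [rewrite divr_ge0 ?sqr_ge0 ?ltW | lra].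
Qed.
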